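(* For every integer $n\geqslant 0$, $$\sum_{k=0}^{\lfloor n/2\rfloor}\ \sum_{q=0}^{n-2k}\ \sum_{r=0}^{q}\binom{n-k}{r}=F_{n+3}+(n-1)2^n$$ (an equality of integers).
   Context: $(F_n)_{n\geqslant 0}$ denotes the Fibonacci numbers: $F_0=0$, $F_1=1$, and $F_{n+2}=F_{n+1}+F_n$ for all $n\geqslant 0$. *)

(* Defs.v *)
From mathcomp Require Import all_boot all_order all_algebra.

Set Implicit Arguments.
Unset Strict Implicit.
Unset Printing Implicit Defensive.

Fixpoint fib (n : nat) : nat :=
  match n with
  | 0 => 0
  | m.+1 => match m with
            | 0 => 1
            | p.+1 => fib m + fib p
            end
  end.

(* Main.v *)
Require Import Defs.
From mathcomp Require Import all_boot all_order all_algebra.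
From mathcomp Require Import zify.
Import GRing.Theory Num.Theory.

(** Write [T m s] ([bin_dsum]) for the sum of the first [s] partial row sums of row [m] of
    Pascal's triangle. Pascal's rule passes through both summations, giving
    [T m.+1 s = T m s + T m s.-1].  The left-hand side of the theorem is
    [S n = \sum_k T (n - k) (n.+1 - 2k)] ([diag_sum]), a sum along a knight's-move diagonal
    of [T].  Applying Pascal's rule to each term of [S n.+2] and shifting the
    index [k] in one of the two resulting sums yields
      [S n.+2 = S n.+1 + S n + T n.+1 n.+3]
    ([diag_sumSS]): a Fibonacci recurrence whose forcing term [T n.+1 n.+3]
    comes from [k = 0].  That term contains the whole row [n.+1], so it has the
    closed form [(n + 5) * 2 ^ n] ([double_sum_row]).  The right-hand side
    satisfies the same recurrence, since [fib] contributes nothing and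
      [(n + 1) * 2 ^ (n + 2) - n * 2 ^ (n + 1) - (n - 1) * 2 ^ n
       = (n + 5) * 2 ^ n].
    Everything is done in [nat], with [2 ^ n] moved to the left, and cast to
    [int] at the end. *)

Definition bin_psum (m q : nat) : nat := \sum_(0 <= r < q) 'C(m, r).

Definition bin_dsum (m s : nat) : nat := \sum_(0 <= q < s) bin_psum m q.+1.

(** The range [k < n.+1] is longer than the natural one, [k <= n./2]. As
    subtraction is truncated the additional terms are empty sums; the uniform
    bound makes the index shift in the recurrence free of parity cases. *)
Definition diag_sum (n : nat) : nat :=
  \sum_(0 <= k < n.+1) bin_dsum (n - k) (n.+1 - 2 * k).

Lemma bin_psum0 m : bin_psum m 0 = 0.
Proof. by rewrite /bin_psum big_geq. Qed.

Lemma bin_psumS m q : bin_psum m.+1 q.+1 = bin_psum m q.+1 + bin_psum m q.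
Proof.
rewrite /bin_psum big_nat_recl // [in RHS]big_nat_recl // !bin0 -addnA.
by rewrite -big_split.
Qed.

Lemma bin_psum_row m q : m < q -> bin_psum m q = 2 ^ m.
Proof.
move=> lt_mq; rewrite /bin_psum (big_cat_nat (n := m.+1)) //=.
rewrite [X in _ + X]big_nat_cond [X in _ + X]big1 ?addn0; last first.
  by move=> r /andP[/andP[lt_mr _] _]; rewrite bin_small.
rewrite big_mkord -[2]/(1 + 1) expnDn; apply: eq_bigr => r _.
by rewrite !exp1n !muln1.
Qed.

Lemma bin_dsum0 m : bin_dsum m 0 = 0.
Proof. by rewrite /bin_dsum big_geq. Qed.

Lemma bin_dsumS m s : bin_dsum m.+1 s = bin_dsum m s + bin_dsum m s.-1.
Proof.
case: s => [|s]; first by rewrite !bin_dsum0.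
rewrite /bin_dsum (eq_bigr _ (fun q _ => bin_psumS m q)) big_split /=.
by rewrite [X in _ + X]big_nat_recl // bin_psum0 add0n.
Qed.

(** Doubled, because [(m + 4) * 2 ^ m.-1] would be wrong at [m = 0]. Pascal's
    rule turns row [m.+1] into two copies of row [m] and one additional full
    row sum [2 ^ m]. *)
Lemma double_sum_row m : 2 * bin_dsum m m.+2 = (m + 4) * 2 ^ m.
Proof.
elim: m => [|m IHm]; first by rewrite /bin_dsum /bin_psum unlock.
have -> : bin_dsum m.+1 m.+3 = 2 * bin_dsum m m.+2 + 2 ^ m.
  rewrite bin_dsumS /= {1}/bin_dsum big_nat_recr //= -/(bin_dsum m m.+2).
  rewrite bin_psum_row; lia.
rewrite IHm expnS; lia.
Qed.

Lemma diag_sumSS n :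
  diag_sum n.+2 = diag_sum n.+1 + diag_sum n + bin_dsum n.+1 n.+3.
Proof.
(* Pascal's rule lowers the row by one and so needs a positive row; the last
   term, in row 0, is split off because it is an empty sum. *)
rewrite {1}/diag_sum big_nat_recr //=.
have -> : n.+3 - 2 * n.+2 = 0 by lia.
rewrite bin_dsum0 addn0.
have pascal k : 0 <= k < n.+2 ->
    bin_dsum (n.+2 - k) (n.+3 - 2 * k) =
    bin_dsum (n.+1 - k) (n.+3 - 2 * k) + bin_dsum (n.+1 - k) (n.+2 - 2 * k).
  move=> lt_kn; have -> : n.+2 - k = (n.+1 - k).+1 by lia.
  by rewrite bin_dsumS; congr (_ + bin_dsum _ _); lia.
rewrite (eq_big_nat _ _ pascal) big_split /= addnC -addnA; congr (_ + _).
(* Isolating [k = 0] leaves [diag_sum n] after the shift [k -> k.+1]. *)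
rewrite big_nat_recl //= muln0 !subn0 addnC; congr (_ + _).
by apply: eq_bigr => k _; congr bin_dsum; lia.
Qed.

Lemma fibSS n : fib n.+2 = fib n.+1 + fib n.
Proof. by []. Qed.

Lemma diag_sum_fib n : diag_sum n + 2 ^ n = fib n.+3 + n * 2 ^ n.
Proof.
suff [] : diag_sum n + 2 ^ n = fib n.+3 + n * 2 ^ n /\
          diag_sum n.+1 + 2 ^ n.+1 = fib n.+4 + n.+1 * 2 ^ n.+1 by [].
elim: n => [|n [IHn IHn1]].
  by rewrite /diag_sum /bin_dsum /bin_psum unlock.
split=> //; rewrite diag_sumSS fibSS.
have := double_sum_row n.+1; move: IHn IHn1; rewrite !expnS; lia.
Qed.

Lemma diag_sum_half n :
  diag_sum n = \sum_(0 <= k < (n./2).+1) bin_dsum (n - k) (n - 2 * k).+1.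
Proof.
rewrite /diag_sum (big_cat_nat (n := (n./2).+1)) //=; last by lia.
rewrite [X in _ + X]big_nat_cond [X in _ + X]big1 ?addn0; last first.
  move=> k /andP[/andP[lt_nk _] _].
  by have -> : n.+1 - 2 * k = 0 by [lia]; rewrite bin_dsum0.
by apply: eq_big_nat => k le_kn; congr bin_dsum; lia.
Qed.

Local Open Scope ring_scope.

Theorem theorem4 (n : nat) :
  \sum_(0 <= k < (n./2).+1)
    \sum_(0 <= q < (n - 2 * k).+1)
      \sum_(0 <= r < q.+1) 'C(n - k, r)%:Z
  = (fib n.+3)%:Z + (n%:Z - 1) * 2 ^+ n :> int.
Proof.
transitivity (diag_sum n)%:Z.
  rewrite diag_sum_half (big_morph Posz PoszD (erefl 0%:Z)).
  apply: eq_bigr => k _; rewrite /bin_dsum (big_morph Posz PoszD (erefl 0%:Z)).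
  apply: eq_bigr => q _; rewrite /bin_psum.
  by rewrite (big_morph Posz PoszD (erefl 0%:Z)).
have /(congr1 Posz) := diag_sum_fib n.
rewrite !PoszD PoszM -[(2 ^ n)%N%:Z]natz natrX => eq_sum.
by rewrite mulrBl mul1r addrA -eq_sum addrK.
Qed.
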